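(* Let $A$ be a finite set, $n\in\mathbb{N}$, and $\varepsilon,r>0$. For any $\mu\in\Pr(A^n)$ there exists a fuzzy partition $(\rho_1,\dots,\rho_k)$ on $A^n$ such that (a) $\mathrm{I}_\mu(\rho_1,\dots,\rho_k)\le 2\,\mathrm{DTC}(\mu)$; (b) $\langle\rho_1\rangle<\varepsilon$; and (c) $\langle\rho_j\rangle>0$ and the measure $\mu_{|\rho_j}$ satisfies $\mathrm{T}(rn/200,r)$ for every $j=2,3,\dots,k$.
   Context: $\langle\cdot\rangle$ denotes integration with respect to $\mu$. A fuzzy partition on $A^n$ is a tuple $(\rho_1,\dots,\rho_k)$ of functions $A^n\to[0,1]$ with $\rho_1+\dots+\rho_k=1$. For $\rho\ge0$ with $\langle\rho\rangle>0$, $\mu_{|\rho}:=\rho\mu/\langle\rho\rangle$. $\mathrm{I}_\mu(\rho_1,\dots,\rho_k)$ is the mutual information $\mathrm{I}(\xi;\zeta)$ for a random pair $(\zeta,\xi)\in[k]\times A^n$ with $\mathbb{P}(\zeta=j,\xi=\mathbf x)=\rho_j(\mathbf x)\mu(\mathbf x)$; equivalently $\sum_j\langle\rho_j\rangle\mathrm{D}(\mu_{|\rho_j}\|\mu)$. If $\xi=(\xi_1,\dots,\xi_n)$ has law $\mu$, the dual total correlation is $\mathrm{DTC}(\mu)=\mathrm{H}(\xi)-\sum_{i=1}^n\mathrm{H}(\xi_i\,|\,\xi_{[n]\setminus\{i\}})$. $A^n$ carries the normalized Hamming metric $d_n(\mathbf a,\mathbf a')=|\{i:a_i\ne a_i'\}|/n$;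 $\overline{d_n}$ is the associated transportation metric (infimum over couplings of $\int d_n$); $\mathrm{D}$ is KL divergence; a measure $\mu$ satisfies $\mathrm{T}(\kappa,r)$ if $\overline{d_n}(\nu,\mu)\le\frac1\kappa\mathrm{D}(\nu\|\mu)+r$ for all $\nu\in\Pr(A^n)$. *)

(* Defs.v *)
From HB Require Import structures.
From mathcomp Require Import all_boot all_order all_algebra.
From mathcomp Require Import boolp classical_sets reals exp.
Set Implicit Arguments. Unset Strict Implicit. Unset Printing Implicit Defensive.
Import Order.TTheory GRing.Theory Num.Theory.
Local Open Scope ring_scope.

Section Defs.
Variable R : realType.

Definition word (A : finType) (n : nat) := {ffun 'I_n -> A}.

Definition is_prob (T : finType) (mu : T -> R) : Prop :=
  (forall x, 0 <= mu x) /\ \sum_(x : T) mu x = 1.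

Definition integ (T : finType) (mu : T -> R) (f : T -> R) : R :=
  \sum_(x : T) f x * mu x.

Definition fuzzy_partition (T : finType) (k : nat) (rho : 'I_k -> T -> R) : Prop :=
  (forall j x, 0 <= rho j x <= 1) /\ (forall x, \sum_(j < k) rho j x = 1).

Definition cond_meas (T : finType) (mu rho : T -> R) : T -> R :=
  fun x => rho x * mu x / integ mu rho.

(* Shannon entropy (natural log; 0 ln 0 = 0 since ln 0 = 0 in the library) *)
Definition entropy (T : finType) (mu : T -> R) : R :=
  - \sum_(x : T) mu x * ln (mu x).

(* KL divergence D(nu || mu), used only when nu << mu *)
Definition KL (T : finType) (nu mu : T -> R) : R :=
  \sum_(x : T) nu x * ln (nu x / mu x).

Definition abs_cont (T : finType) (nu mu : T -> R) : Prop :=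
  forall x, mu x = 0 -> nu x = 0.

Definition mutual_info (J T : finType) (p : J -> T -> R) : R :=
  \sum_(j : J) \sum_(x : T)
     p j x * ln (p j x / ((\sum_(y : T) p j y) * (\sum_(i : J) p i x))).

Definition I_mu (T : finType) (k : nat) (mu : T -> R) (rho : 'I_k -> T -> R) : R :=
  mutual_info (fun j x => rho j x * mu x).

(* H(xi_i | xi_{[n]\{i}}) = - sum_x mu(x) ln (mu(x) / P(xi_{-i} = x_{-i})) *)
Definition marg_out (A : finType) (n : nat) (mu : word A n -> R) (i : 'I_n)
  (x : word A n) : R :=
  \sum_(y : word A n | [forall j, (j != i) ==> (y j == x j)]) mu y.

Definition cond_entropy_i (A : finType) (n : nat) (mu : word A n -> R) (i : 'I_n) : R :=
  - \sum_(x : word A n) mu x * ln (mu x / marg_out mu i x).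

Definition DTC (A : finType) (n : nat) (mu : word A n -> R) : R :=
  entropy mu - \sum_(i < n) cond_entropy_i mu i.

Definition hamming (A : finType) (n : nat) (a b : word A n) : R :=
  (#|[set i : 'I_n | a i != b i]|)%:R / n%:R.

Definition coupling (T : finType) (nu mu : T -> R) (pi : T -> T -> R) : Prop :=
  (forall a b, 0 <= pi a b) /\
  (forall a, \sum_(b : T) pi a b = nu a) /\
  (forall b, \sum_(a : T) pi a b = mu b).

Definition dbar (A : finType) (n : nat) (nu mu : word A n -> R) : R :=
  inf [set c : R | exists pi, coupling nu mu pi /\
         c = \sum_(a : word A n) \sum_(b : word A n) pi a b * hamming a b].

Definition satisfies_T (A : finType) (n : nat) (mu : word A n -> R) (kappa r : R) : Prop :=
  forall nu : word A n -> R, is_prob nu -> abs_cont nu mu ->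
    dbar nu mu <= KL nu mu / kappa + r.

End Defs.

(* Main.v *)
Require Import Defs.
From HB Require Import structures.
From mathcomp Require Import all_boot all_order all_algebra.
From mathcomp Require Import boolp classical_sets reals sequences exp.
From mathcomp Require Import ring lra.
Import Order.TTheory GRing.Theory Num.Theory.
Local Open Scope ring_scope.

(* Splitting xi by a binary zeta lowers the average DTC by
   I(xi; zeta) - sum_i I(xi_i; zeta | xi_{-i}).  If mu violates T(rn/200, r),
   Kantorovich duality and the Gibbs variational principle give a 1-Lipschitz
   g whose exponential moment at kappa = rn/200 is large; hence for some
   t <= kappa the tilt of mu by exp(t g) has relative entropy at least
   50 t^2 / n.  For zeta with conditional probability proportional to exp(t g),
   g changes by at most 1/n along each coordinate, so each conditional
   information is O((t/n)^2), and the sum over i is at most half of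
   I(xi; zeta).  Each violating piece can thus be split so that information is
   paid for by twice the decrease of DTC, with a gain bounded below in terms of
   n and r.  A decomposition of nearly maximal information under this budget
   has violating pieces of total mass < eps, which are merged into rho_1. *)

(** * Entropy and relative entropy of finite weights *)

Section Entropy.
Set Implicit Arguments.
Unset Strict Implicit.
Variable R : realType.

Lemma ln_le_sub1 (x : R) : 0 < x -> ln x <= x - 1.
Proof.
move=> x0; have := @le_ln1Dx R (x - 1); have -> : 1 + (x - 1) = x by ring.
by apply; lra.
Qed.

Lemma mul_ln_div_ge (p q : R) : 0 <= p -> 0 <= q -> (q = 0 -> p = 0) ->
  p - q <= p * ln (p / q).
Proof.
rewrite le_eqVlt => /predU1P[<-|p0]; first by rewrite mul0r => ? _; lra.
rewrite le_eqVlt => /predU1P[<- /(_ erefl)|q0 _]; first by move=> pE; lra.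
have /ln_le_sub1 : 0 < q / p by rewrite divr_gt0.
have -> : ln (p / q) = - ln (q / p) by rewrite -lnV ?posrE ?divr_gt0// invf_div.
rewrite -(ler_pM2l p0) mulrBr mulr1 [p * (q / p)]mulrC divfK ?gt_eqF//; lra.
Qed.

(** Summing the pointwise bound [p - q <= p * ln (p / q)], itself [ln s <= s - 1] at [s = q / p],
    gives the claim as soon as [q] has at most the total mass of [p]. *)
Lemma gibbs_inequality (T : finType) (p q : T -> R) :
  (forall x, 0 <= p x) -> (forall x, 0 <= q x) -> abs_cont p q ->
  \sum_x q x <= \sum_x p x -> 0 <= \sum_x p x * ln (p x / q x).
Proof.
move=> p0 q0 pq qp; apply: (@le_trans _ _ (\sum_x (p x - q x))).
  by rewrite sumrB subr_ge0.
by apply: ler_sum => x _; apply: mul_ln_div_ge => //; apply: pq.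
Qed.

Section Weights.
Variable T : finType.
Implicit Types u v w : T -> R.

(* Functionals of measures are extended to weights [w = rho * mu] with degree 1:
   [ent w] is [- mass w] times the entropy of [w / mass w], and [I_mu] becomes
   the sum of the [ent (rho_j mu)] minus [ent mu]. *)
Definition mass w : R := \sum_x w x.

Definition ent w : R := \sum_x w x * ln (w x / mass w).

(** [mass u] times the KL divergence of [u / mass u] from [w / mass w]. *)
Definition relent u w : R := \sum_x u x * ln (u x / (w x * (mass u / mass w))).

Lemma mass_ge0 w : (forall x, 0 <= w x) -> 0 <= mass w.
Proof. by move=> w0; apply: sumr_ge0. Qed.

Lemma le_mass w x : (forall y, 0 <= w y) -> w x <= mass w.
Proof. by move=> w0; rewrite /mass (bigD1 x)//= lerDl sumr_ge0. Qed.

Lemma mass_eq0 w : (forall x, 0 <= w x) -> mass w = 0 -> forall x, w x = 0.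
Proof.
move=> w0 m0 x; apply/eqP; rewrite eq_le w0 andbT.
by rewrite -m0; exact: le_mass.
Qed.

Lemma ent_le0 w : (forall x, 0 <= w x) -> ent w <= 0.
Proof.
move=> w0; apply: sumr_le0 => x _; have [->|wx] := eqVneq (w x) 0.
  by rewrite mul0r.
have wx0 : 0 < w x by rewrite lt_def wx w0.
have m0 : 0 < mass w by apply: lt_le_trans wx0 (le_mass x w0).
rewrite mulr_ge0_le0//; apply: ln_le0.
by rewrite ler_pdivrMr// mul1r le_mass.
Qed.

Lemma relent_ge0 u w : (forall x, 0 <= u x) -> (forall x, u x <= w x) ->
  0 <= relent u w.
Proof.
move=> u0 uw; have w0 x : 0 <= w x by exact: le_trans (uw x).
have mu0 := mass_ge0 u0; have mw0 := mass_ge0 w0.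
have muw : mass u <= mass w by apply: ler_sum.
apply: gibbs_inequality => //.
- by move=> x; rewrite mulr_ge0// divr_ge0.
- move=> x /eqP; rewrite !mulf_eq0 invr_eq0.
  case/or3P => /eqP h0.
  + by apply/eqP; rewrite eq_le u0 -h0 uw.
  + exact: mass_eq0.
  + by apply/eqP; rewrite eq_le u0 -(mass_eq0 w0 h0 x) uw.
- rewrite -mulr_suml -/(mass w) mulrC; have [->|mw] := eqVneq (mass w) 0.
    by rewrite mulr0.
  by rewrite divfK.
Qed.

(** The information carried by the binary label of the splitting: since [u + v = w], the cross terms
    with [ln (w x / mass w)] add up to [ent w]. *)
Lemma ent_split u v w : (forall x, 0 <= u x) -> (forall x, 0 <= v x) ->
  (forall x, w x = u x + v x) -> ent u + ent v - ent w = relent u w + relent v w.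
Proof.
move=> u0 v0 wE; have w0 x : 0 <= w x by rewrite wE addr_ge0.
have key z : (forall x, 0 <= z x) -> (forall x, z x <= w x) ->
    ent z - \sum_x z x * ln (w x / mass w) = relent z w.
  move=> z0 zw; rewrite -sumrB; apply: eq_bigr => x _.
  have [->|zx] := eqVneq (z x) 0; first by rewrite !mul0r subrr.
  have zx0 : 0 < z x by rewrite lt_def zx z0.
  have wx0 : 0 < w x by apply: lt_le_trans (zw x).
  have mz0 : 0 < mass z by apply: lt_le_trans (le_mass x z0).
  have mw0 : 0 < mass w by apply: lt_le_trans (le_mass x w0).
  rewrite -mulrBr -ln_div ?posrE ?divr_gt0//; congr (_ * ln _).
  by field; rewrite !gt_eqF.
rewrite -(key u) => [|//|x]; last by rewrite wE lerDl.
rewrite -(key v) => [|//|x]; last by rewrite wE lerDr.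
suff -> : ent w = \sum_x u x * ln (w x / mass w) + \sum_x v x * ln (w x / mass w).
  by ring.
by rewrite -big_split/=; apply: eq_bigr => x _; rewrite -mulrDl -wE.
Qed.

Lemma ent_superadd u v : (forall x, 0 <= u x) -> (forall x, 0 <= v x) ->
  ent (fun x => u x + v x) <= ent u + ent v.
Proof.
move=> u0 v0; rewrite -subr_ge0 (ent_split u0 v0)// addr_ge0//.
- by apply: relent_ge0 => // x; rewrite lerDl.
- by apply: relent_ge0 => // x; rewrite lerDr.
Qed.

End Weights.

(** * Marginals, the chain rule and nonnegativity of dual total correlation *)

Section Words.
Variables (A : finType) (n : nat).
Implicit Types (u v w : word A n -> R) (x y : word A n) (S : {set 'I_n}).

(* [mass w] times the DTC of [w / mass w] *)
Definition wdtc w : R := - ent w - \sum_(i < n) cond_entropy_i w i.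

Definition agree (S : {set 'I_n}) x y := [forall j, (j \in S) ==> (y j == x j)].

(** Marginals stay functions of full words, so those for different [S] can be compared pointwise. *)
Definition marg w (S : {set 'I_n}) x : R := \sum_(y | agree S x y) w y.

Lemma agreeP S x y : reflect (forall j, j \in S -> y j = x j) (agree S x y).
Proof.
apply: (iffP forallP) => [h j jS|h j]; first by have := h j; rewrite jS => /eqP.
by apply/implyP => jS; rewrite h.
Qed.

Lemma agree_refl S x : agree S x x. Proof. exact/agreeP. Qed.

Lemma agreeC S x y : agree S x y = agree S y x.
Proof. by apply/agreeP/agreeP => h j jS; rewrite h. Qed.

Lemma agree_transl S x y z : agree S x y -> agree S x z = agree S y z.
Proof.
by move=> /agreeP xy; apply/agreeP/agreeP => h j jS; rewrite h// xy.
Qed.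

Lemma marg_outE w i x : marg_out w i x = marg w (~: [set i]) x.
Proof.
apply: eq_bigl => y; apply: eq_forallb => j; by rewrite !inE.
Qed.

Lemma marg_setT w x : marg w [set: 'I_n]%SET x = w x.
Proof.
rewrite /marg (big_pred1 x)// => y; apply/agreeP/eqP => [h|-> //].
by apply/ffunP => j; apply: h.
Qed.

Lemma marg_set0 w x : marg w finset.set0 x = mass w.
Proof. by apply: eq_bigl => y; apply/agreeP => j; rewrite inE. Qed.

Lemma le_marg w S x : (forall y, 0 <= w y) -> w x <= marg w S x.
Proof.
move=> w0; rewrite /marg (bigD1 x) ?agree_refl//= lerDl.
by apply: sumr_ge0.
Qed.

Lemma marg_ge0 w S x : (forall y, 0 <= w y) -> 0 <= marg w S x.
Proof. by move=> w0; apply: sumr_ge0. Qed.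

Lemma eq_marg w S x y : agree S x y -> marg w S x = marg w S y.
Proof. by move=> xy; apply: eq_bigl => z; apply: agree_transl. Qed.

Lemma marg_fiber_sum w S i x : i \notin S ->
  \sum_(y | agree (~: [set i]) x y) marg w (i |: S) y = marg w S x.
Proof.
move=> iS; rewrite /marg (exchange_big_dep xpredT)//= [RHS]big_mkcond/=.
(* Each [z] agreeing with [x] on [S] is counted once, through the word [y0] equal to [z] at [i] and
   to [x] elsewhere. *)
apply: eq_bigr => z _; pose y0 : word A n := [ffun j => if j == i then z i else x j].
have [/agreeP xz|nxz] := ifPn.
  rewrite (big_pred1 y0)// => y; apply/andP/eqP => [[/agreeP yx /agreeP zy]|->].
    apply/ffunP => j; rewrite ffunE; have [->|ji] := eqVneq j i.
      by rewrite zy// !inE eqxx.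
    by rewrite yx// !inE.
  split; apply/agreeP => j; rewrite !inE ffunE; first by move=> /negPf ->.
  by have [->//|_/= jS] := eqVneq j i; rewrite xz.
rewrite big_pred0// => y; apply: contraNF nxz => /andP[/agreeP yx /agreeP zy].
apply/agreeP => j jS; rewrite zy ?inE ?jS ?orbT// yx// !inE.
by apply: contraNneq iS => <-.
Qed.

(** The summand is the weight obtained by keeping the coordinates off [i] and redrawing coordinate
    [i] given those in [S] only. Summing over the fibre in direction [i] first gives back [w y]. *)
Lemma marg_chain_sum w S i : (forall x, 0 <= w x) -> i \notin S ->
  \sum_x marg w (~: [set i]) x * (marg w (i |: S) x / marg w S x) <= mass w.
Proof.
move=> w0 iS.
under eq_bigr => x _ do rewrite {1}/marg mulr_suml.
rewrite (exchange_big_dep xpredT)//=; apply: ler_sum => y _.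
rewrite (eq_bigl (fun x => agree (~: [set i]) y x)); last first.
  by move=> x; rewrite agreeC.
rewrite (eq_bigr (fun x => w y / marg w S y * marg w (i |: S) x)).
  rewrite -mulr_sumr marg_fiber_sum//.
  have [->|my] := eqVneq (marg w S y) 0; first by rewrite mulr0.
  by rewrite divfK.
move=> x xy; rewrite (@eq_marg w S x y); first by rewrite [RHS]mulrAC mulrA.
apply/agreeP => j jS; move/agreeP: xy => -> //.
by rewrite !inE; apply: contraNneq iS => <-.
Qed.

(* Conditioning on all other coordinates yields less entropy than conditioning
   on fewer of them. *)
Lemma ln_marg_step w S i : (forall x, 0 <= w x) -> i \notin S ->
  \sum_x w x * (ln (marg w (i |: S) x) - ln (marg w S x)) <=
  - cond_entropy_i w i.
Proof.
move=> w0 iS; rewrite opprK -subr_ge0 -sumrB.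
have g0 S' x := @marg_ge0 w S' x w0.
(* The relative entropy of [w] from the redrawn weight is the difference of the two conditional
   entropies. *)
have := @gibbs_inequality _ w
  (fun x => marg w (~: [set i]) x * (marg w (i |: S) x / marg w S x)) w0.
have pos S' x : 0 < w x -> 0 < marg w S' x by move=> h; apply: lt_le_trans (le_marg S' x w0).
move=> h; apply: le_trans (h _ _ _) _.
- by move=> x; rewrite mulr_ge0// divr_ge0.
- move=> x qx; apply/eqP; apply: contra_eqT qx => wx.
  have wx0 : 0 < w x by rewrite lt_def wx w0.
  by rewrite !mulf_neq0 ?invr_eq0// gt_eqF// pos.
- exact: marg_chain_sum.
apply: ler_sum => x _; have [->|wx] := eqVneq (w x) 0; first by rewrite !mul0r subrr.
have wx0 : 0 < w x by rewrite lt_def wx w0.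
rewrite -mulrBr ler_pM2l// marg_outE.
by rewrite !ln_div ?posrE ?mulr_gt0 ?invr_gt0 ?pos// lnM ?posrE ?mulr_gt0 ?invr_gt0 ?pos// ln_div ?posrE ?pos// opprD addrA.
Qed.

(** The chain rule writes the entropy as a sum of conditional entropies given the preceding
    coordinates, the first [k] of which form [P k]; each is at least the one given all other
    coordinates. *)
Lemma wdtc_ge0 w : (forall x, 0 <= w x) -> 0 <= wdtc w.
Proof.
move=> w0; pose P k := [set i : 'I_n | (i < k)%N].
have step k : (k <= n)%N ->
    \sum_x w x * (ln (marg w (P k) x) - ln (mass w)) <=
    - \sum_(i < n | (i < k)%N) cond_entropy_i w i.
  elim: k => [_|k IH kn].
    rewrite big1 => [|x _]; last first.
      rewrite (_ : P 0%N = finset.set0) ?marg_set0 ?subrr ?mulr0//.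
    by rewrite big_pred0 ?oppr0.
  pose i := Ordinal kn.
  have PE : P k.+1 = i |: P k.
    by apply/finset.setP => j; rewrite !inE ltnS leq_eqVlt -val_eqE.
  have iP : i \notin P k by rewrite inE ltnn.
  rewrite (bigD1 i)//= opprD (eq_bigl (fun j : 'I_n => (j < k)%N)); last first.
    by move=> j; rewrite ltnS -val_eqE/= ltn_neqAle andbC.
  apply: le_trans (lerD (ln_marg_step w0 iP) (IH (ltnW kn))).
  rewrite -big_split/=; apply: ler_sum => x _; rewrite PE -mulrDr.
  by rewrite ler_wpM2l//; lra.
have := step n (leqnn n); rewrite [X in _ <= - X](eq_bigl xpredT); last by move=> i; rewrite ltn_ord.
rewrite (_ : P n = [set: 'I_n]%SET); last by apply/finset.setP => i; rewrite !inE ltn_ord.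
rewrite /wdtc => h.
suff -> : ent w = \sum_x w x * (ln (marg w [set: 'I_n]%SET x) - ln (mass w)) by lra.
apply: eq_bigr => x _; have [->|wx] := eqVneq (w x) 0; first by rewrite !mul0r.
have wx0 : 0 < w x by rewrite lt_def wx w0.
by rewrite marg_setT ln_div// posrE; apply: lt_le_trans (le_mass x w0).
Qed.

End Words.
End Entropy.

(** * Linear minorants of sublinear functionals *)

Section HahnBanach.
Set Implicit Arguments.
Unset Strict Implicit.
Variables (R : realType) (V : lmodType R).
Local Open Scope classical_set_scope.

Definition sublinear (p : V -> R) : Prop :=
  (forall x y, p (x + y) <= p x + p y) /\ (forall a x, 0 <= a -> p (a *: x) <= a * p x).

Lemma sublinear_ge0 p : sublinear p -> 0 <= p 0.
Proof. by case=> pD _; have := pD 0 0; rewrite addr0; lra. Qed.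

Lemma sublinear_scale p a x : sublinear p -> 0 <= a -> p (a *: x) = a * p x.
Proof.
move=> pS a0; apply/eqP; rewrite eq_le (pS.2 _ _ a0)/=.
move: a0; rewrite le0r => /predU1P[->|a0].
  by rewrite scale0r mul0r sublinear_ge0.
have := pS.2 a^-1 (a *: x); rewrite scalerA mulVf ?gt_eqF// scale1r.
by rewrite invr_ge0 => /(_ (ltW a0)); rewrite ler_pdivlMl.
Qed.

Definition slack (p : V -> R) (v h : V) : set R :=
  [set c | exists2 t, 0 <= t & c = p (h + t *: v) - t * p v].

(* Taking [t = 1] at [h = - v] shows that this minorant is linear along [v]. *)
Definition linearize p v h : R := inf (slack p v h).

Lemma slack_has_lbound p v h : sublinear p -> has_lbound (slack p v h).
Proof.
move=> pS; exists (- p (- h)) => _ [t t0 ->].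
have := pS.1 (h + t *: v) (- h).
by rewrite addrAC subrr add0r sublinear_scale//; lra.
Qed.

Lemma linearize_le p v h t : sublinear p -> 0 <= t ->
  linearize p v h <= p (h + t *: v) - t * p v.
Proof. by move=> pS t0; apply: ge_inf; [exact: slack_has_lbound|exists t]. Qed.

Lemma le_linearize p v h c :
  (forall t, 0 <= t -> c <= p (h + t *: v) - t * p v) -> c <= linearize p v h.
Proof.
move=> hc; apply: lb_le_inf => [|_ [t t0 ->]]; last exact: hc.
by exists (p (h + 0 *: v) - 0 * p v); exists 0.
Qed.

Lemma linearize_sublinear p v : sublinear p -> sublinear (linearize p v).
Proof.
move=> pS; split=> [x y|a x].
  rewrite -lerBlDr; apply: le_linearize => s s0; rewrite lerBlDr -lerBlDl.
  apply: le_linearize => t t0; rewrite lerBlDl.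
  apply: le_trans (linearize_le v (x + y) pS (addr_ge0 s0 t0)) _.
  have := pS.1 (x + s *: v) (y + t *: v).
  by rewrite addrACA -scalerDl mulrDl; lra.
rewrite le0r => /predU1P[->|a0].
  rewrite scale0r mul0r; apply: le_trans (linearize_le v 0 pS (lexx 0)) _.
  by rewrite scale0r addr0 mul0r subr0 -(scale0r 0) sublinear_scale// mul0r.
rewrite -ler_pdivrMl//; apply: le_linearize => t t0; rewrite ler_pdivrMl//.
apply: le_trans (linearize_le v (a *: x) pS (mulr_ge0 (ltW a0) t0)) _.
by rewrite -scalerA -scalerDr (sublinear_scale _ pS (ltW a0)) mulrBr mulrA.
Qed.

Lemma linearize_le_id p v h : sublinear p -> linearize p v h <= p h.
Proof.
by move=> pS; have := linearize_le v h pS (lexx 0); rewrite scale0r addr0 mul0r subr0.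
Qed.

Lemma linearizeN p v : sublinear p -> linearize p v (- v) <= - p v.
Proof.
move=> pS; have := linearize_le v (- v) pS ler01; rewrite scale1r addNr mul1r.
by rewrite -[p 0](_ : 0 = _) ?sub0r// -(scale0r 0) sublinear_scale// mul0r.
Qed.

(** Linearise along the vectors of [s] one after another. The inequality [q (- v) <= - q v] survives
    later steps because they only lower [q]. *)
Lemma sublinear_minorant p (s : seq V) : sublinear p ->
  exists q, [/\ sublinear q, forall h, q h <= p h & {in s, forall v, q (- v) <= - q v}].
Proof.
move=> pS; elim: s => [|v s [q [qS qp qs]]]; first by exists p.
exists (linearize q v); have lS := linearize_sublinear v qS; split=> // [h|x].
  exact: le_trans (linearize_le_id v h qS) (qp h).
have le1 h := linearize_le_id v h qS.
rewrite inE => /predU1P[->|xs].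
  by apply: le_trans (linearizeN v qS) _; rewrite lerN2.
by apply: le_trans (le1 _) _; apply: le_trans (qs x xs) _; rewrite lerN2.
Qed.

End HahnBanach.

(** * Hahn-Banach on a finite-dimensional function space *)

Section FiniteHahnBanach.
Set Implicit Arguments.
Unset Strict Implicit.
Variables (R : realType) (X : finType).

Lemma finite_hahn_banach (p : {ffun X -> R^o} -> R) (v : {ffun X -> R^o}) :
  sublinear p ->
  exists L : X -> R, (forall h : {ffun X -> R^o}, \sum_x L x * h x <= p h) /\ p v <= \sum_x L x * v x.
Proof.
move=> pS; pose e (x : X) : {ffun X -> R^o} := [ffun y => (y == x)%:R].
(* Linearising along [v] first forces [q (- v) <= - p v]; linearising along the basis then makes [q]
   linear with coefficients [q (e x)]. *)
have [q [qS qv qs]] := sublinear_minorant [seq e x | x <- enum X] (linearize_sublinear v pS).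
have qe x : q (- e x) <= - q (e x) by apply: qs; rewrite map_f// mem_enum.
have q_line a x : q (a *: e x) <= a * q (e x).
  have [a0|a0] := leP 0 a; first by rewrite sublinear_scale.
  have -> : a *: e x = (- a) *: (- e x) by rewrite scalerN scaleNr opprK.
  rewrite sublinear_scale//; last by rewrite oppr_ge0 ltW.
  by have := ler_wnM2l (ltW a0) (qe x); lra.
have decomp (h : {ffun X -> R^o}) : h = \sum_x h x *: e x.
  apply/ffunP => y; rewrite sum_ffunE (bigD1 y)//= !ffunE eqxx /GRing.scale/= mulr1.
  by rewrite big1 ?addr0// => x xy; rewrite !ffunE eq_sym (negPf xy) /GRing.scale/= mulr0.
have q_le h : q h <= \sum_x h x * q (e x).
  rewrite {1}(decomp h); elim/big_rec2: _ => [|x a b _ ab].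
    by rewrite -(scale0r 0) sublinear_scale// mul0r.
  by apply: le_trans (qS.1 _ _) _; rewrite lerD.
have q_ge (h : {ffun X -> R^o}) : \sum_x q (e x) * h x <= q h.
  have := q_le (- h); under eq_bigr do rewrite ffunE mulNr mulrC.
  rewrite sumrN; have := qS.1 h (- h); rewrite subrr.
  by have := sublinear_ge0 qS; lra.
exists (fun x => q (e x)); split=> [h|].
  exact: le_trans (q_ge h) (le_trans (qv h) (linearize_le_id v h pS)).
have := q_ge (- v); under eq_bigr do rewrite ffunE mulrN.
rewrite sumrN; have := qv (- v); have := linearizeN v pS; lra.
Qed.

End FiniteHahnBanach.

(** * Kantorovich duality on a finite set *)

Section Kantorovich.
Set Implicit Arguments.
Unset Strict Implicit.
Variables (R : realType) (T : finType).
Local Open Scope classical_set_scope.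

Definition dual_value (nu mu phi psi : T -> R) : R :=
  \sum_a phi a * nu a + \sum_b psi b * mu b.

(** The infimum of this set is the sublinear functional of [h] to which Hahn-Banach is applied; the
    integral of [h] against the product measure bounds it below. *)
Definition majorant (nu mu : T -> R) (h : {ffun T * T -> R^o}) : set R :=
  [set c | exists phi psi, (forall a b, h (a, b) <= phi a + psi b) /\
             c = dual_value nu mu phi psi].

Lemma dual_value_product (nu mu phi psi : T -> R) : is_prob nu -> is_prob mu ->
  dual_value nu mu phi psi = \sum_a \sum_b (phi a + psi b) * (nu a * mu b).
Proof.
move=> [_ nu1] [_ mu1].
under [RHS]eq_bigr => a _ do (under eq_bigr => b _ do rewrite mulrDl; rewrite big_split/=).
rewrite big_split/=; congr (_ + _).
  apply: eq_bigr => a _; rewrite -mulr_sumr -mulr_sumr mu1 mulr1//.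
rewrite exchange_big/=; apply: eq_bigr => b _; rewrite -mulr_sumr -mulr_suml nu1 mul1r//.
Qed.

Section Duality.
Variables nu mu : T -> R.
Hypotheses (hnu : is_prob nu) (hmu : is_prob mu).
Implicit Types (h : {ffun T * T -> R^o}) (phi psi : T -> R).

Lemma majorant_has_lbound h : has_lbound (majorant nu mu h).
Proof.
exists (\sum_a \sum_b h (a, b) * (nu a * mu b)) => _ [phi [psi [le_h ->]]].
rewrite dual_value_product//; apply: ler_sum => a _; apply: ler_sum => b _.
by rewrite ler_wpM2r// mulr_ge0 ?hnu.1 ?hmu.1.
Qed.

Lemma majorant_nonempty h : majorant nu mu h !=set0.
Proof.
pose C := \sum_x `|h x|; exists (dual_value nu mu (fun=> C) (fun=> 0)).
exists (fun=> C), (fun=> 0); split=> // a b; rewrite addr0.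
apply: le_trans (ler_norm _) _; rewrite /C (bigD1 (a, b))//= lerDl.
exact: sumr_ge0.
Qed.

Lemma inf_majorant_le h phi psi : (forall a b, h (a, b) <= phi a + psi b) ->
  inf (majorant nu mu h) <= dual_value nu mu phi psi.
Proof. by move=> le_h; apply: ge_inf (majorant_has_lbound h) _ _; exists phi, psi. Qed.

Lemma inf_majorant_sublinear : sublinear (fun h => inf (majorant nu mu h)).
Proof.
have ge_bound h c : (forall phi psi, (forall a b, h (a, b) <= phi a + psi b) ->
    c <= dual_value nu mu phi psi) -> c <= inf (majorant nu mu h).
  move=> hc; apply: lb_le_inf (majorant_nonempty h) _ => _ [phi [psi [le_h ->]]].
  exact: hc.
have dualD f g f' g' : dual_value nu mu (fun a => f a + f' a) (fun a => g a + g' a) =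
    dual_value nu mu f g + dual_value nu mu f' g'.
  rewrite /dual_value [RHS]addrACA -!big_split/=.
  by apply: eq_bigr => a _; rewrite !mulrDl.
have dualZ c f g : dual_value nu mu (fun a => c * f a) (fun a => c * g a) =
    c * dual_value nu mu f g.
  rewrite /dual_value mulrDr !mulr_sumr.
  by congr (_ + _); apply: eq_bigr => a _; rewrite mulrA.
split=> [x y|a x].
  rewrite -lerBlDr; apply: (ge_bound) => f g fg; rewrite lerBlDr -lerBlDl.
  apply: (ge_bound) => f' g' fg'; rewrite lerBlDl -dualD; apply: inf_majorant_le => b c.
  by rewrite ffunE; have := fg b c; have := fg' b c; lra.
rewrite le0r => /predU1P[->|a0].
  apply: (@le_trans _ _ (dual_value nu mu (fun=> 0) (fun=> 0))).
    by apply: inf_majorant_le => b c; rewrite !ffunE /GRing.scale/= mul0r addr0.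
  by rewrite /dual_value !big1 ?mul0r ?addr0// => b _; rewrite mul0r.
rewrite -ler_pdivrMl//; apply: (ge_bound) => f g fg; rewrite ler_pdivrMl// -dualZ.
by apply: inf_majorant_le => b c; rewrite ffunE /GRing.scale/= -mulrDr; apply: ler_wpM2l (fg b c); exact: ltW.
Qed.

(* Hahn-Banach yields a positive functional on functions of two variables that
   integrates [phi a + psi b] as [nu] and [mu] do, i.e. a coupling. *)
Lemma kantorovich_duality (d : T -> T -> R) (c : R) :
  (forall pi, coupling nu mu pi -> c < \sum_a \sum_b pi a b * d a b) ->
  exists phi psi, (forall a b, phi a + psi b <= d a b) /\ c < dual_value nu mu phi psi.
Proof.
(* With [v = - d], majorants of [v] are the negatives of dual potentials for [d]. *)
move=> hc; pose v : {ffun T * T -> R^o} := [ffun x => - d x.1 x.2].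
have [L [Lp Lv]] := finite_hahn_banach v inf_majorant_sublinear.
have pairE (F : T * T -> R) : \sum_x F x = \sum_a \sum_b F (a, b).
  by rewrite pair_bigA/=; apply: eq_bigr => -[].
have Ldual phi psi : \sum_a \sum_b L (a, b) * (phi a + psi b) <= dual_value nu mu phi psi.
  pose h : {ffun T * T -> R^o} := [ffun x => phi x.1 + psi x.2].
  have := le_trans (Lp h) (@inf_majorant_le h phi psi _); rewrite pairE.
  under eq_bigr => a _ do under eq_bigr => b _ do rewrite ffunE.
  by apply => a b; rewrite ffunE.

have coup : coupling nu mu (fun a b => L (a, b)).
  have Leq phi psi : \sum_a \sum_b L (a, b) * (phi a + psi b) = dual_value nu mu phi psi.
    apply/eqP; rewrite eq_le Ldual/=.
    have := Ldual (fun a => - phi a) (fun b => - psi b).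
    rewrite /dual_value; under [X in _ <= X + _]eq_bigr do rewrite mulNr.
    under [X in _ <= _ + X]eq_bigr do rewrite mulNr.
    rewrite !sumrN -opprD lerNr => h; apply: le_trans h _.
    rewrite -sumrN; apply: ler_sum => a _; rewrite -sumrN; apply: ler_sum => b _.
    by rewrite -mulrN !opprB opprK addrC.
  split; [|split].
  (* Positivity: minus an indicator is majorised by [phi = psi = 0]. *)
  - move=> a0 b0; pose h : {ffun T * T -> R^o} := [ffun x => - (x == (a0, b0))%:R].
    have := le_trans (Lp h) (@inf_majorant_le h (fun=> 0) (fun=> 0) _).
    rewrite (bigD1 (a0, b0))//= ffunE eqxx big1 => [|x xab]; last first.
      by rewrite ffunE (negPf xab) oppr0 mulr0.
    rewrite /dual_value !big1 => [|b _|b _]; rewrite ?mul0r// !addr0 mulrN1 oppr_le0.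
    by apply=> a b; rewrite ffunE oppr_le0 ler0n.
  - move=> a; have := Leq (fun x => (x == a)%:R) (fun=> 0).
    rewrite /dual_value [X in _ + X]big1 => [|b _]; last by rewrite mul0r.
    rewrite (bigD1 a)//= [X in _ + X]big1 => [|b ba]; last first.
      by rewrite big1// => z _; rewrite (negPf ba) addr0 mulr0.
    rewrite [X in _ = X + _](bigD1 a)//= [X in _ = _ + X + _]big1 => [|b ba]; last first.
      by rewrite (negPf ba) mul0r.
    rewrite eqxx !addr0 mul1r => <-.
    by apply: eq_bigr => b _; rewrite mulr1.
  - move=> b; have := Leq (fun=> 0) (fun x => (x == b)%:R).
    rewrite exchange_big/= /dual_value [X in X + _]big1 => [|a _]; last by rewrite mul0r.
    rewrite (bigD1 b)//= [X in _ + X]big1 => [|a ab]; last first.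
      by rewrite big1// => z _; rewrite (negPf ab) addr0 mulr0.
    rewrite [X in _ = _ + X](bigD1 b)//= [X in _ = _ + (_ + X)]big1 => [|a ab]; last first.
      by rewrite (negPf ab) mul0r.
    rewrite eqxx !addr0 !add0r mul1r => <-.
    by apply: eq_bigr => a _; rewrite mulr1.
have := hc _ coup; rewrite -[X in _ < X]opprK ltrNr => cL.
have := le_lt_trans Lv; rewrite pairE => /(_ (- c)).
have -> : \sum_a \sum_b L (a, b) * v (a, b) = - \sum_a \sum_b L (a, b) * d a b.
  rewrite -sumrN; apply: eq_bigr => a _; rewrite -sumrN; apply: eq_bigr => b _.
  by rewrite ffunE mulrN.
(* If the coupling [L] costs more than [c], the infimum at [v] is below [- c], so some majorant has
   value below [- c]; negate it. *)
move=> /(_ cL) /(inf_lt (majorant_nonempty v)).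
case=> _ [phi [psi [le_v ->]]] lt_c.
exists (fun a => - phi a), (fun b => - psi b); split=> [a b|].
  by have := le_v a b; rewrite ffunE/=; lra.
rewrite /dual_value; under eq_bigr do rewrite mulNr.
under [X in _ < _ + X]eq_bigr do rewrite mulNr.
by rewrite !sumrN -opprD ltrNr.
Qed.

End Duality.

Lemma coupling_product (nu mu : T -> R) : is_prob nu -> is_prob mu ->
  coupling nu mu (fun a b => nu a * mu b).
Proof.
move=> [nu0 nu1] [mu0 mu1]; split=> [a b|]; first exact: mulr_ge0.
by split=> [a|b]; rewrite -(mulr_sumr, mulr_suml) (mu1, nu1) (mulr1, mul1r).
Qed.

End Kantorovich.

(** * Transportation distance and Lipschitz observables *)

Section Transport.
Set Implicit Arguments.
Unset Strict Implicit.
Variables (R : realType) (A : finType) (n : nat).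
Implicit Types (nu mu f : word A n -> R).

Lemma hamming_ge0 (a b : word A n) : 0 <= hamming R a b.
Proof. by rewrite divr_ge0. Qed.

Lemma hamming_le1 (a b : word A n) : hamming R a b <= 1.
Proof.
rewrite /hamming; case: (posnP n) => [n0|n0].
  by rewrite [X in _ / X%:R]n0 invr0 mulr0.
rewrite ler_pdivrMr ?ltr0n// mul1r ler_nat; apply: leq_trans (max_card _) _.
by rewrite card_ord.
Qed.

Lemma hamming_triangle (a b c : word A n) :
  hamming R a c <= hamming R a b + hamming R b c.
Proof.
rewrite /hamming -mulrDl ler_wpM2r ?invr_ge0// -natrD ler_nat.
apply: leq_trans (leq_card_setU _ _); apply/subset_leq_card/fintype.subsetP => i.
rewrite !inE -negb_and; apply: contraNN => /andP[/eqP -> /eqP ->]; exact: eqxx.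
Qed.

Lemma hamming_fiber (a b : word A n) (i : 'I_n) :
  (forall j, j != i -> b j = a j) -> hamming R a b <= n%:R^-1.
Proof.
move=> ab; rewrite -[leRHS]mul1r ler_wpM2r ?invr_ge0// lern1.
rewrite -(cards1 i); apply/subset_leq_card/fintype.subsetP => j; rewrite !inE.
by apply: contraNT => /ab ->.
Qed.

Definition lipschitz1 f : Prop := forall a b, f a - f b <= hamming R a b.

Lemma dbar_le nu mu pi : coupling nu mu pi ->
  dbar nu mu <= \sum_a \sum_b pi a b * hamming R a b.
Proof.
move=> hpi; apply: ge_inf; last by exists pi.
exists 0 => _ [q [[q0 _] ->]]; apply: sumr_ge0 => a _; apply: sumr_ge0 => b _.
by rewrite mulr_ge0// hamming_ge0.
Qed.

Lemma dbar_le1 nu mu : is_prob nu -> is_prob mu -> dbar nu mu <= 1.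
Proof.
move=> hnu hmu; apply: le_trans (dbar_le (coupling_product hnu hmu)) _.
apply: (@le_trans _ _ (\sum_a \sum_b nu a * mu b)).
  apply: ler_sum => a _; apply: ler_sum => b _.
  by rewrite ler_piMr ?hamming_le1// mulr_ge0 ?hnu.1 ?hmu.1.
by under eq_bigr do rewrite -mulr_sumr hmu.2 mulr1; rewrite hnu.2.
Qed.

(** Replace the dual pair by [f a], the minimum over [b] of [hamming a b - psi b]. The triangle
    inequality makes [f] 1-Lipschitz, and [phi <= f <= - psi]. *)
Lemma dbar_lipschitz nu mu c : is_prob nu -> is_prob mu -> c < dbar nu mu ->
  exists2 f, lipschitz1 f & c < \sum_a f a * nu a - \sum_b f b * mu b.
Proof.
move=> hnu hmu hc.
have [phi [psi [le_d lt_c]]] := @kantorovich_duality _ _ nu mu hnu hmu (@hamming R A n) c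
  (fun pi hpi => lt_le_trans hc (dbar_le hpi)).
have [a0 _] : exists a : word A n, True.
  apply: contrapT => nw; have := hnu.2; rewrite big1 => [/eqP|x].
    by rewrite eq_sym oner_eq0.
  by have := nw (ex_intro _ x I).
pose g a b := hamming R a b - psi b.
pose m a := [arg min_(b < a0) g a b]%O.
have gm a b : g a (m a) <= g a b by rewrite /m; case: arg_minP => // c' _; apply.
exists (fun a => g a (m a)) => [a b|].
  have := gm a (m b); have := hamming_triangle a b (m b); rewrite /g; lra.
apply: lt_le_trans lt_c _; rewrite /dual_value -sumrN lerD//; apply: ler_sum => a _.
  by rewrite ler_wpM2r ?hnu.1//; have := le_d a (m a); rewrite /g; lra.
rewrite -mulNr ler_wpM2r ?hmu.1// lerNr; have := gm a a; rewrite /g.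
have -> : hamming R a a = 0; last by lra.
rewrite /hamming (_ : #|_| = 0%N) ?mul0r//; apply: eq_card0 => i.
by rewrite !inE eqxx.
Qed.

End Transport.

(** * Exponential tilts and their relative entropy *)

Section Tilting.
Set Implicit Arguments.
Unset Strict Implicit.
Variables (R : realType) (T : finType).
Implicit Types (m g : T -> R).

Lemma expR_le_inv1B (x : R) : x < 1 -> expR x <= (1 - x)^-1.
Proof.
move=> x1; rewrite -[x in expR x]opprK expRN lef_pV2 ?posrE ?expR_gt0 ?subr_gt0//.
exact: expR_ge1Dx.
Qed.

Lemma expR_le_quad (x : R) : `|x| <= 2^-1 -> expR x <= 1 + x + 2 * x ^+ 2.
Proof.
rewrite ler_norml => /andP[x1 x2]; have x3 : 0 < 1 - x by lra.
apply: le_trans (expR_le_inv1B _) _; first by lra.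
rewrite -[leLHS]mul1r ler_pdivrMr//; nra.
Qed.

Lemma expR_le_lin (x : R) : 0 <= x -> x <= 2^-1 -> expR x <= 1 + 2 * x.
Proof.
move=> x1 x2; have x3 : 0 < 1 - x by lra.
apply: le_trans (expR_le_inv1B _) _; first by lra.
rewrite -[leLHS]mul1r ler_pdivrMr//; nra.
Qed.

Definition mgf m g (t : R) : R := \sum_x m x * expR (t * g x).

Lemma mgf_gt0 m g t : is_prob m -> 0 < mgf m g t.
Proof.
move=> [m0 m1]; rewrite lt_def; apply/andP; split; last first.
  by apply: sumr_ge0 => x _; rewrite mulr_ge0 ?expR_ge0.
apply/eqP => z0; have mx0 x : m x = 0.
  have/eqP := @mass_eq0 R T (fun x => m x * expR (t * g x))
    (fun x => mulr_ge0 (m0 x) (expR_ge0 _)) z0 x.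
  by rewrite mulf_eq0 expR_eq0 orbF => /eqP.
by have := m1; rewrite big1// => /eqP; rewrite eq_sym oner_eq0.
Qed.

(** Gibbs inequality for [nu] against the normalised tilt of [m] by [expR (t * g)]. *)
Lemma donsker_varadhan m g nu t : is_prob m -> is_prob nu -> abs_cont nu m ->
  t * \sum_x g x * nu x - KL nu m <= ln (mgf m g t).
Proof.
move=> hm hnu num; have Z0 := mgf_gt0 g t hm.
pose q x := m x * expR (t * g x) / mgf m g t.
have : 0 <= \sum_x nu x * ln (nu x / q x).
  apply: gibbs_inequality => //; first exact: hnu.1.
  - by move=> x; rewrite !mulr_ge0 ?hm.1 ?expR_ge0 ?invr_ge0 ?ltW.
  - move=> x /eqP; rewrite !mulf_eq0 invr_eq0 expR_eq0 (gt_eqF Z0) !orbF => /eqP.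
    exact: num.
  - by rewrite -mulr_suml divff ?gt_eqF// hnu.2.
suff -> : \sum_x nu x * ln (nu x / q x) =
    KL nu m - t * (\sum_x g x * nu x) + (\sum_x nu x) * ln (mgf m g t).
  by rewrite hnu.2 mul1r; lra.
rewrite mulr_sumr mulr_suml -sumrB -big_split/=; apply: eq_bigr => x _.
have [->|nx] := eqVneq (nu x) 0; first by rewrite !(mul0r, mulr0) subr0 addr0.
have nx0 : 0 < nu x by rewrite lt_def nx hnu.1.
have mx0 : 0 < m x.
  by rewrite lt_def hm.1 andbT; apply: contra_neq nx; exact: num.
rewrite /q !ln_div ?posrE ?mulr_gt0 ?expR_gt0 ?invr_gt0//.
rewrite lnM ?posrE ?expR_gt0// expRK; ring.
Qed.

(** [mgf m g t] times the relative entropy, with respect to [m], of its tilt at [t]. *)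
Definition tilted_gap m g (t : R) : R :=
  \sum_x m x * expR (t * g x) * (t * g x - ln (mgf m g t)).

(** Gibbs inequality for the tilt at [t] against the tilt at [t / 2]. *)
Lemma tilted_gap_ge m g t : is_prob m ->
  mgf m g t * (ln (mgf m g t) - 2 * ln (mgf m g (t / 2))) <= tilted_gap m g t.
Proof.
move=> hm; have Z0 := mgf_gt0 g t hm; have Y0 := mgf_gt0 g (t / 2) hm.
pose p x := m x * expR (t * g x) / mgf m g t.
pose q x := m x * expR (t / 2 * g x) / mgf m g (t / 2).
have sumE s : 0 < mgf m g s -> \sum_x m x * expR (s * g x) / mgf m g s = 1.
  by move=> s0; rewrite -mulr_suml divff ?gt_eqF.
have : 0 <= \sum_x p x * ln (p x / q x).
  apply: gibbs_inequality => //.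
  - by move=> x; rewrite !mulr_ge0 ?hm.1 ?expR_ge0 ?invr_ge0 ?ltW.
  - by move=> x; rewrite !mulr_ge0 ?hm.1 ?expR_ge0 ?invr_ge0 ?ltW.
  - move=> x /eqP; rewrite !mulf_eq0 invr_eq0 expR_eq0 (gt_eqF Y0) !orbF => /eqP mx0.
    by rewrite /p mx0 !mul0r.
  - by rewrite !sumE.
have -> : \sum_x p x * ln (p x / q x) =
    \sum_x (m x * expR (t * g x) * (t * g x - ln (mgf m g t)) / (2 * mgf m g t) -
            m x * expR (t * g x) * (ln (mgf m g t) / 2 - ln (mgf m g (t / 2))) / mgf m g t).
  apply: eq_bigr => x _; have [mx|mx] := eqVneq (m x) 0.
    by rewrite /p mx !mul0r subr0.
  have mx0 : 0 < m x by rewrite lt_def mx hm.1.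
  rewrite /p /q !ln_div ?posrE ?mulr_gt0 ?expR_gt0 ?invr_gt0//.
  rewrite !lnM ?posrE ?expR_gt0// !expRK; field; rewrite gt_eqF//.
rewrite sumrB -!mulr_suml -/(tilted_gap m g t) -/(mgf m g t) subr_ge0.
rewrite [_ * _ / mgf m g t]mulrAC divff ?gt_eqF// mul1r => h.
rewrite -(@ler_pM2r _ ((2 * mgf m g t)^-1)) ?invr_gt0 ?mulr_gt0//; apply: le_trans h.
rewrite le_eqVlt; apply/orP; left; apply/eqP; field; rewrite gt_eqF//.
Qed.

(** The linear term of the exponential integrates to zero because [g] is centred. *)
Lemma ln_mgf_le m g t : is_prob m -> (forall x, `|g x| <= 1) -> \sum_x g x * m x = 0 ->
  0 <= t -> t <= 2^-1 -> ln (mgf m g t) <= 2 * t ^+ 2.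
Proof.
move=> hm g1 g0 t0 t2; apply: le_trans (ln_le_sub1 (mgf_gt0 g t hm)) _.
rewrite lerBlDr.
apply: (@le_trans _ _ (\sum_x (m x + t * (g x * m x) + 2 * t ^+ 2 * m x))).
  apply: ler_sum => x _.
  have h1 : expR (t * g x) <= 1 + t * g x + 2 * (t * g x) ^+ 2.
    by apply: expR_le_quad; rewrite normrM ger0_norm//; have := g1 x; have := normr_ge0 (g x); nra.
  have h2 : (t * g x) ^+ 2 <= t ^+ 2.
    rewrite exprMn -[leRHS]mulr1 ler_wpM2l ?sqr_ge0//.
    by rewrite -real_normK ?num_real// exprn_ile1.
  have := ler_wpM2l (hm.1 x) h1; have := ler_wpM2l (hm.1 x) h2; lra.
by rewrite !big_split/= -!mulr_sumr hm.2 g0; lra.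
Qed.

(* If the relative entropies of all dyadic tilts were below [a t^2], halving
   [kappa] repeatedly would bound [ln mgf] quadratically. *)
Lemma exists_tilt m g (a kappa : R) N : is_prob m -> (forall x, `|g x| <= 1) ->
  \sum_x g x * m x = 0 -> 0 <= a -> 0 <= kappa -> kappa / 2 ^+ N <= 2^-1 ->
  2 * a * kappa ^+ 2 + 2 * kappa ^+ 2 / 2 ^+ N < ln (mgf m g kappa) ->
  exists t, [/\ kappa / 2 ^+ N <= t, t <= kappa &
                a * t ^+ 2 * mgf m g t <= tilted_gap m g t].
Proof.
move=> hm g1 g0 a0; elim: N kappa => [|N IH] kappa k0 kN hk.
  rewrite expr0 divr1 in kN hk; have := ln_mgf_le hm g1 g0 k0 kN.
  have : 0 <= a * kappa ^+ 2 by rewrite mulr_ge0// sqr_ge0.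
  by lra.
have P0 : 0 < 2 ^+ N :> R by rewrite exprn_gt0.
have kE : kappa / 2 ^+ N.+1 = kappa / 2 / 2 ^+ N.
  by rewrite [2 ^+ N.+1]exprS; field; rewrite gt_eqF.
have kle : kappa / 2 ^+ N.+1 <= kappa / 2.
  rewrite kE ler_pdivrMr// -[leLHS]mulr1 ler_wpM2l ?divr_ge0//.
  by rewrite -natrX ler1n expn_gt0.
(* Either [kappa] itself serves, or [tilted_gap_ge] passes the lower bound on [ln mgf] to
   [kappa / 2]; its two terms are scaled so that it reproduces exactly with [N] in place of
   [N.+1]. *)
have [gap|gap] := leP (a * kappa ^+ 2 * mgf m g kappa) (tilted_gap m g kappa).
  by exists kappa; split=> //; lra.
have [|||t [t1 t2 t3]] := IH (kappa / 2); rewrite -?kE//; first lra; last first.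
  by exists t; split=> //; lra.
have := le_lt_trans (tilted_gap_ge g kappa hm) gap.
rewrite mulrC ltr_pM2r ?mgf_gt0// => h.
have E1 : 2 * kappa ^+ 2 / 2 ^+ N.+1 = kappa ^+ 2 / 2 ^+ N.
  by rewrite [2 ^+ N.+1]exprS; field; rewrite gt_eqF.
have E2 : 2 * (kappa / 2) ^+ 2 / 2 ^+ N = kappa ^+ 2 / 2 ^+ N / 2.
  by field; rewrite gt_eqF.
by rewrite E1 in hk; rewrite E2; lra.
Qed.

End Tilting.

(** * Splitting a weight that violates the transport inequality *)

Section Splitting.
Set Implicit Arguments.
Unset Strict Implicit.
Variables (R : realType) (A : finType) (n : nat).
Implicit Types (u v w rho : word A n -> R) (x y : word A n).

(* [ln s <= s - 1] turns both logarithms into the chi-square bound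
   [(q - b)^2 / (b (1 - b))]. *)
Lemma binary_relent_le (q b delta : R) : 0 < q -> q <= 2^-1 -> 0 < b -> b <= 2^-1 ->
  0 <= delta -> delta <= 2^-1 -> q <= (1 + 2 * delta) * b -> b <= (1 + 2 * delta) * q ->
  q * ln (q / b) + (1 - q) * ln ((1 - q) / (1 - b)) <= 16 * delta ^+ 2 * q.
Proof.
move=> q0 q2 b0 b2 d0 d2 qb bq.
have l1 : q * ln (q / b) <= q * (q / b - 1).
  by rewrite ler_pM2l// ln_le_sub1// divr_gt0.
have l2 : (1 - q) * ln ((1 - q) / (1 - b)) <= (1 - q) * ((1 - q) / (1 - b) - 1).
  rewrite ler_pM2l; last lra.
  by rewrite ln_le_sub1// divr_gt0//; lra.
apply: le_trans (lerD l1 l2) _.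
have -> : q * (q / b - 1) + (1 - q) * ((1 - q) / (1 - b) - 1) =
    (q - b) ^+ 2 / (b * (1 - b)).
  by field; rewrite !gt_eqF//; lra.
rewrite ler_pdivrMr; last by rewrite mulr_gt0//; lra.
(* Both ratio bounds give [|q - b| <= 2 * delta * b]; then [b <= 2 * q] and [1 <= 2 * (1 - b)]
   produce the constant 16. *)
have h : (q - b) ^+ 2 <= (2 * delta * b) ^+ 2.
  have hb : b - q <= 2 * delta * b.
    have [qb'|bq'] := leP q b; last by apply: (@le_trans _ _ 0); [lra|rewrite !mulr_ge0// ltW].
    have := ler_wpM2l d0 qb'; lra.
  by rewrite -subr_ge0 subr_sqr mulr_ge0//; lra.
have : delta ^+ 2 * b * b <= delta ^+ 2 * b * (2 * q).
  apply: ler_wpM2l; first by rewrite mulr_ge0 ?sqr_ge0// ltW.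
  by nra.
have : delta ^+ 2 * b * q * 1 <= delta ^+ 2 * b * q * (2 * (1 - b)).
  apply: ler_wpM2l; first by rewrite !mulr_ge0 ?sqr_ge0// ltW.
  by lra.
lra.
Qed.

(** The left side is [w x] times the binary relative entropy of [rho x] from [b], the [w]-average of
    [rho] over the fibre of [x] in direction [i]; hence [b] is within a factor [1 + 2 * delta] of
    [rho x]. *)
Lemma fiber_split_le w rho i delta x
    (u := fun y => rho y * w y) (v := fun y => (1 - rho y) * w y) :
  (forall y, 0 <= w y) -> (forall y, 0 < rho y) -> (forall y, rho y <= 2^-1) ->
  0 <= delta -> delta <= 2^-1 ->
  (forall y z, agree (~: [set i]) y z -> rho z <= (1 + 2 * delta) * rho y) ->
  u x * ln (u x / marg_out u i x) + v x * ln (v x / marg_out v i x)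
    - w x * ln (w x / marg_out w i x) <= 16 * delta ^+ 2 * u x.
Proof.
move=> w0 r0 r2 d0 d2 rL.
have [wx|wx] := eqVneq (w x) 0.
  by rewrite /u /v wx !(mulr0, mul0r) subr0 addr0.
have wx0 : 0 < w x by rewrite lt_def wx w0.
rewrite !marg_outE; set S := ~: [set i].
have M0 : 0 < marg w S x by apply: lt_le_trans (le_marg S x w0).
pose b := marg u S x / marg w S x.
have uE : marg u S x = b * marg w S x by rewrite divfK ?gt_eqF.
have vE : marg v S x = (1 - b) * marg w S x.
  rewrite mulrBl mul1r -uE /marg -sumrB; apply: eq_bigr => y _.
  by rewrite /v /u mulrBl mul1r.
have b_le c : (forall y, agree S x y -> rho y <= c) -> b <= c.
  move=> hc; rewrite ler_pdivrMr// /marg mulr_sumr; apply: ler_sum => y xy.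
  by rewrite ler_wpM2r// hc.
have b_ge c : (forall y, agree S x y -> c <= rho y) -> c <= b.
  move=> hc; rewrite ler_pdivlMr// /marg mulr_sumr; apply: ler_sum => y xy.
  by rewrite ler_wpM2r// hc.
have e0 : 0 < 1 + 2 * delta by lra.
have b1 : rho x / (1 + 2 * delta) <= b.
  apply: (b_ge) => y xy; rewrite ler_pdivrMr// mulrC.
  by apply: rL; rewrite agreeC.
have b2 : b <= (1 + 2 * delta) * rho x by apply: (b_le) => y; apply: rL.
have b0 : 0 < b by apply: lt_le_trans b1; rewrite divr_gt0.
have b3 : b <= 2^-1 by apply: (b_le) => y _.
have q1 : 0 < 1 - rho x by have := r2 x; lra.
have q2 : 0 < 1 - b by lra.
clearbody b.
have b1' : rho x <= (1 + 2 * delta) * b by rewrite -ler_pdivrMl// mulrC.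
have h := binary_relent_le (r0 x) (r2 x) b0 b3 d0 d2 b1' b2.
rewrite uE vE /u /v.
rewrite !ln_div ?posrE ?mulr_gt0//.
rewrite !lnM ?posrE//.
rewrite !ln_div ?posrE// in h.
have := ler_wpM2r (w0 x) h; lra.
Qed.

(** The left side is [mass w] times the conditional information between coordinate [i] and the label
    given the other coordinates. *)
Lemma cond_entropy_split w rho i delta
    (u := fun y => rho y * w y) (v := fun y => (1 - rho y) * w y) :
  (forall y, 0 <= w y) -> (forall y, 0 < rho y) -> (forall y, rho y <= 2^-1) ->
  0 <= delta -> delta <= 2^-1 ->
  (forall y z, agree (~: [set i]) y z -> rho z <= (1 + 2 * delta) * rho y) ->
  cond_entropy_i w i - cond_entropy_i u i - cond_entropy_i v i <=
  16 * delta ^+ 2 * mass u.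
Proof.
move=> w0 r0 r2 d0 d2 rL.
rewrite /cond_entropy_i !opprK /mass mulr_sumr -sumrN -!big_split/=.
apply: ler_sum => x _; have := fiber_split_le x w0 r0 r2 d0 d2 rL.
by rewrite -/u -/v -/(u x) -/(v x); lra.
Qed.

(* Along an admissible splitting the information gained is paid for by twice
   the loss of dual total correlation, i.e. [potential] does not increase. *)
Definition potential w : R := ent w + 2 * wdtc w.

Lemma split_potential w rho delta c
    (u := fun y => rho y * w y) (v := fun y => (1 - rho y) * w y) :
  (forall y, 0 <= w y) -> (forall y, 0 < rho y) -> (forall y, rho y <= 2^-1) ->
  0 <= delta -> delta <= 2^-1 ->
  (forall i y z, agree (~: [set i]) y z -> rho z <= (1 + 2 * delta) * rho y) ->
  c * mass u <= relent u w -> 32 * n%:R * delta ^+ 2 <= c ->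
  potential u + potential v <= potential w /\ ent w + c * mass u <= ent u + ent v.
Proof.
move=> w0 r0 r2 d0 d2 rL cu dc.
have u0 y : 0 <= u y by rewrite mulr_ge0// ltW.
have v0 y : 0 <= v y by rewrite mulr_ge0//; have := r2 y; lra.
have wE y : w y = u y + v y by rewrite /u /v; ring.
have split := ent_split u0 v0 wE.
have rv : 0 <= relent v w by apply: relent_ge0 => // y; rewrite wE lerDr.
split; last by lra.
have : \sum_(i < n) (cond_entropy_i w i - cond_entropy_i u i - cond_entropy_i v i) <=
    \sum_(i < n) 16 * delta ^+ 2 * mass u.
  by apply: ler_sum => i _; apply: cond_entropy_split => // y z; apply: rL.
rewrite !sumrB sumr_const card_ord -[_ *+ n]mulr_natl => h.
have := ler_wpM2r (mass_ge0 u0) dc; rewrite /potential /wdtc; lra.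
Qed.

Lemma scaled_prob w : (forall x, 0 <= w x) -> 0 < mass w ->
  is_prob (fun x => w x / mass w).
Proof.
move=> w0 m0; split=> [x|]; first by rewrite divr_ge0// ltW.
by rewrite -mulr_suml divff// gt_eqF.
Qed.

(** [u] is a constant multiple of the tilt of [m], and [relent u w / mass u] ignores constant
    factors. *)
Lemma relent_tilt w g t (m := fun x => w x / mass w)
    (u := fun x => 2^-1 * expR (t * (g x - 1)) * w x) :
  (forall x, 0 <= w x) -> 0 < mass w ->
  mass u * tilted_gap m g t = relent u w * mgf m g t.
Proof.
move=> w0 m0; have Z0 : 0 < mgf m g t by apply: mgf_gt0; apply: scaled_prob.
have uE x : u x = 2^-1 * expR (- t) * mass w * (m x * expR (t * g x)).
  by rewrite /u /m mulrBr mulr1 expRD; field; rewrite gt_eqF.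
have muE : mass u = 2^-1 * expR (- t) * mass w * mgf m g t.
  by rewrite /mgf mulr_sumr; apply: eq_bigr => x _; rewrite uE.
rewrite muE mulrAC; congr (_ * _); rewrite /tilted_gap mulr_sumr; apply: eq_bigr => x _.
rewrite muE [LHS]mulrA -uE; have [wx|wx] := eqVneq (w x) 0.
  by rewrite /u wx mulr0 !mul0r.
have wx0 : 0 < w x by rewrite lt_def wx w0.
congr (_ * _).
have -> : u x / (w x * (2^-1 * expR (- t) * mass w * mgf m g t / mass w)) =
    expR (t * g x) / mgf m g t.
  by rewrite uE /m; field; rewrite !gt_eqF ?expR_gt0.
by rewrite ln_div ?posrE ?expR_gt0// expRK.
Qed.

Definition bad (r : R) w : Prop :=
  0 < mass w /\ ~ satisfies_T (fun x => w x / mass w) (r * n%:R / 200) r.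

(** The first factors bound [mass u / mass w] below for the split-off piece [u]; the last bounds
    [50 / n * t ^+ 2] below, as [t >= kappa / 2 ^+ n]. *)
Definition gain (r : R) : R :=
  let kappa := r * n%:R / 200 in
  2^-1 * expR (- 2 * kappa) * (50 / n%:R * (kappa / 2 ^+ n) ^+ 2).

(** All distances vanish when [n = 0], and [dbar] never exceeds 1. *)
Lemma bad_nontrivial (r : R) w : 0 < r -> (forall x, 0 <= w x) -> bad r w -> (0 < n)%N /\ r < 1.
Proof.
move=> r0 w0 [m0 nT].
have hm := scaled_prob w0 m0.
split.
  rewrite lt0n; apply/eqP => n0; apply: nT => nu hnu num.
  have := @dbar_le R A n nu _ _ (coupling_product hnu hm).
  rewrite big1 => [h|a _]; last first.
    by rewrite big1// => b _; rewrite /hamming [X in _ / X%:R]n0 invr0 !mulr0.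
  by rewrite [X in _ * X%:R]n0 mulr0 mul0r invr0 mulr0 add0r; lra.
rewrite ltNge; apply/negP => r1; apply: nT => nu hnu num.
apply: le_trans (dbar_le1 hnu hm) _; apply: le_trans r1 _; rewrite lerDr divr_ge0//.
  apply: gibbs_inequality => //; rewrite ?hnu.2 ?hm.2//; [exact: hnu.1|exact: hm.1].
by rewrite divr_ge0// mulr_ge0// ltW.
Qed.

(** A Lipschitz function witnessing the violation, centred at its mean, is fed into
    [donsker_varadhan]; the KL terms cancel. *)
Lemma bad_observable (r : R) w (m := fun x => w x / mass w) (kappa := r * n%:R / 200) :
  0 < r -> (forall x, 0 <= w x) -> bad r w ->
  exists g, [/\ lipschitz1 g, forall x, `|g x| <= 1, \sum_x g x * m x = 0 &
                kappa * r < ln (mgf m g kappa)].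
Proof.
move=> r0 w0 wbad; have [n0 r1] := bad_nontrivial r0 w0 wbad; have [m0 nT] := wbad.
have hm : is_prob m := scaled_prob w0 m0.
have k0 : 0 < kappa by rewrite divr_gt0// mulr_gt0// ltr0n.
have [nu [hnu num lt_d]] : exists nu, [/\ is_prob nu, abs_cont nu m &
    KL nu m / kappa + r < dbar nu m].
  apply: contrapT => nex; apply: nT => nu hnu num; rewrite leNgt; apply/negP => lt_d.
  by apply: nex; exists nu.
have [f fL lt_f] := dbar_lipschitz hnu hm lt_d.
pose e := \sum_x f x * m x.
have sumB p : is_prob p -> \sum_x (f x - e) * p x = \sum_x f x * p x - e.
  move=> hp; under eq_bigr do rewrite mulrBl.
  by rewrite sumrB -mulr_sumr hp.2 mulr1.
exists (fun x => f x - e); split.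
- by move=> a b; have := fL a b; lra.
- move=> x; have fx y : `|f x - f y| <= 1.
    have := fL x y; have := fL y x; have := hamming_le1 R x y; have := hamming_le1 R y x.
    by rewrite ler_norml => *; apply/andP; split; lra.
  have -> : f x - e = \sum_y (f x - f y) * m y.
    under eq_bigr do rewrite mulrBl.
    by rewrite sumrB -mulr_sumr hm.2 mulr1.
  apply: le_trans (ler_norm_sum _ _ _) _; rewrite -hm.2; apply: ler_sum => y _.
  by rewrite normrM (ger0_norm (hm.1 y)) ler_piMl ?hm.1.
- by rewrite sumB// subrr.
- have := @donsker_varadhan _ _ m (fun x => f x - e) nu kappa hm hnu num.
  rewrite sumB//; apply: lt_le_trans.
  rewrite -/e in lt_f; have := lt_f; rewrite -(ltr_pM2l k0) mulrDr [kappa * (_ / _)]mulrC.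
  by rewrite divfK ?gt_eqF//; lra.
Qed.

Lemma bad_split (r : R) w : 0 < r -> (forall x, 0 <= w x) -> bad r w ->
  exists u v, [/\ forall x, 0 <= u x, forall x, 0 <= v x, forall x, w x = u x + v x,
    potential u + potential v <= potential w &
    ent w + gain r * mass w <= ent u + ent v].
Proof.
move=> r0 w0 wbad; have [n0 r1] := bad_nontrivial r0 w0 wbad.
have [g [gL g1 g0 gT]] := bad_observable r0 w0 wbad.
have [m0 _] := wbad; set m := fun x => w x / mass w in g0 gT.
have hm : is_prob m := scaled_prob w0 m0.
set kappa := r * n%:R / 200 in gT *.
have N0 : 0 < n%:R :> R by rewrite ltr0n.
have k0 : 0 < kappa by rewrite divr_gt0// mulr_gt0.
have P0 : 0 < 2 ^+ n :> R by rewrite exprn_gt0.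
have nP : n%:R <= 2 ^+ n :> R by rewrite -natrX ler_nat ltnW// ltn_expl.
have kP : kappa / 2 ^+ n <= r / 200.
  rewrite ler_pdivrMr//; have := ler_wpM2l (ltW r0) nP; rewrite /kappa; lra.
(* With [a = 50 / n] the first term of the threshold is [kappa * r / 2]; [N = n] halvings make the
   second at most [kappa * r / 100]. *)
have [||||t [t1 t2 t3]] := @exists_tilt _ _ m g (50 / n%:R) kappa n hm g1 g0.
- by rewrite divr_ge0.
- exact: ltW.
- by lra.
- apply: le_lt_trans gT.
  have -> : 2 * (50 / n%:R) * kappa ^+ 2 = kappa * r / 2.
    by rewrite /kappa; field; rewrite gt_eqF.
  have -> : 2 * kappa ^+ 2 / 2 ^+ n = 2 * kappa * (kappa / 2 ^+ n).
    by field; rewrite gt_eqF.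
  have := ler_wpM2l (ltW k0) kP; nra.
(* The shift by 1 and the factor 1/2 keep [rho] at most 1/2, as [g <= 1]. *)
pose rho x := 2^-1 * expR (t * (g x - 1)).
pose u x := rho x * w x; pose v x := (1 - rho x) * w x.
have t0 : 0 < t by apply: lt_le_trans t1; rewrite divr_gt0.
have rho0 x : 0 < rho x by rewrite mulr_gt0 ?invr_gt0// expR_gt0.
have rho2 x : rho x <= 2^-1.
  rewrite -[leRHS]mulr1 ler_pM2l ?invr_gt0// expR_le1.
  by have := g1 x; rewrite ler_norml => /andP[_ ?]; nra.
have rho_ge x : 2^-1 * expR (- 2 * kappa) <= rho x.
  rewrite ler_pM2l ?invr_gt0// ler_expR.
  by have := g1 x; rewrite ler_norml => /andP[? _]; nra.
have d0 : 0 <= t / n%:R by rewrite divr_ge0// ltW.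
have d2 : t / n%:R <= 2^-1.
  by rewrite ler_pdivrMr//; apply: le_trans t2 _; rewrite /kappa; nra.
(* Changing one coordinate moves [g] by at most [1 / n], hence [delta = t / n]. *)
have rhoL i y z : agree (~: [set i]) y z -> rho z <= (1 + 2 * (t / n%:R)) * rho y.
  move=> /agreeP yz; rewrite /rho mulrCA ler_pM2l ?invr_gt0//.
  have -> : t * (g z - 1) = t * (g z - g y) + t * (g y - 1) by ring.
  rewrite expRD ler_pM2r ?expR_gt0//; apply: le_trans (expR_le_lin d0 d2).
  rewrite ler_expR ler_pM2l//; apply: le_trans (gL z y) _.
  by apply: (@hamming_fiber _ _ _ _ _ i) => j ji; rewrite yz// !inE.
have u0 x : 0 <= u x by rewrite mulr_ge0// ltW.
have cu : 50 / n%:R * t ^+ 2 * mass u <= relent u w.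
  have Z0 := mgf_gt0 g t hm.
  rewrite -(ler_pM2r Z0) -(relent_tilt g t w0 m0) -/m mulrAC mulrC.
  by apply: ler_wpM2l => //; exact: mass_ge0.
have dc : 32 * n%:R * (t / n%:R) ^+ 2 <= 50 / n%:R * t ^+ 2.
  have -> : 32 * n%:R * (t / n%:R) ^+ 2 = 32 / n%:R * t ^+ 2.
    by field; rewrite gt_eqF.
  by rewrite ler_wpM2r ?sqr_ge0// ler_wpM2r ?invr_ge0 ?ltW//; lra.
have [pot en] := split_potential w0 rho0 rho2 d0 d2 rhoL cu dc.
exists u, v; split=> //.
- by move=> x; rewrite mulr_ge0//; have := rho2 x; lra.
- by move=> x; rewrite /u /v; ring.
apply: le_trans en; rewrite lerD2l /gain -/kappa.
have mu_ge : 2^-1 * expR (- 2 * kappa) * mass w <= mass u.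
  by rewrite /mass mulr_sumr; apply: ler_sum => x _; rewrite ler_wpM2r.
have t_ge : (kappa / 2 ^+ n) ^+ 2 <= t ^+ 2.
  have k2 : 0 <= kappa / 2 ^+ n by rewrite divr_ge0 ?ltW.
  by apply: lerXn2r => //; rewrite nnegrE ltW.
rewrite mulrAC mulrC; apply: ler_pM => //.
- by rewrite mulr_ge0 ?sqr_ge0// divr_ge0.
- by rewrite !mulr_ge0 ?invr_ge0 ?expR_ge0// ltW.
- by rewrite ler_wpM2l// divr_ge0.
Qed.

End Splitting.

(** * Families of weights and their refinement *)

Section Decomposition.
Set Implicit Arguments.
Unset Strict Implicit.
Variables (R : realType) (A : finType) (n : nat).
Implicit Types (w : word A n -> R) (s : seq (word A n -> R)).

Definition nonneg s : Prop := forall k x, 0 <= nth (fun=> 0) s k x.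

Definition seq_ent s : R := \sum_(w <- s) ent w.
Definition seq_potential s : R := \sum_(w <- s) potential w.
Definition seq_sum s : word A n -> R := fun x => \sum_(w <- s) w x.

Definition bad_mass (r : R) s : R := \sum_(w <- s | `[< bad r w >]) mass w.

Lemma nonneg_cons w s : nonneg (w :: s) <-> (forall x, 0 <= w x) /\ nonneg s.
Proof.
split=> [h|[w0 s0] [|k]//]; last exact: s0.
by split=> [x|k x]; [exact: h 0%N x|exact: h k.+1 x].
Qed.

Lemma nonneg_filter (p : pred (word A n -> R)) s : nonneg s -> nonneg [seq w <- s | p w].
Proof.
elim: s => //= w s IH /nonneg_cons[w0 /IH s0].
by case: ifP => // _; apply/nonneg_cons.
Qed.

Lemma seq_sum_ge0 s x : nonneg s -> 0 <= seq_sum s x.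
Proof.
rewrite /seq_sum; elim: s => [|w s IH]; first by rewrite big_nil.
by move=> /nonneg_cons[w0 /IH s0]; rewrite big_cons addr_ge0.
Qed.

Lemma seq_ent_le0 s : nonneg s -> seq_ent s <= 0.
Proof.
rewrite /seq_ent; elim: s => [|w s IH]; first by rewrite big_nil.
move=> /nonneg_cons[w0 /IH s0]; rewrite big_cons.
by have := ent_le0 w0; lra.
Qed.

(** Merging pieces can only lose information. *)
Lemma ent_seq_sum s : nonneg s -> ent (seq_sum s) <= seq_ent s.
Proof.
rewrite /seq_ent; elim: s => [|w s IH].
  move=> _; rewrite big_nil /ent big1// => x _.
  by rewrite /seq_sum big_nil mul0r.
move=> /nonneg_cons[w0 s0]; rewrite big_cons.
have -> : seq_sum (w :: s) = fun x => w x + seq_sum s x.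
  by apply/funext => x; rewrite /seq_sum big_cons.
apply: le_trans (ent_superadd w0 (fun x => seq_sum_ge0 x s0)) _.
by have := IH s0; lra.
Qed.

Lemma refine_bad (r : R) s : 0 < r -> nonneg s ->
  exists s', [/\ nonneg s', forall x, seq_sum s' x = seq_sum s x,
    seq_potential s' <= seq_potential s &
    seq_ent s + gain n r * bad_mass r s <= seq_ent s'].
Proof.
move=> r0; elim: s => [|w s IH].
  by exists [::]; split=> //; rewrite /bad_mass big_nil mulr0 addr0.
move=> /nonneg_cons[w0 /IH[s' [s'0 s'E s'p s'e]]].
rewrite /seq_sum /seq_potential /seq_ent /bad_mass in s'E s'p s'e *.
have [wb|wg] := pselect (bad r w).
  have [u [v [u0 v0 wE uvp uve]]] := bad_split r0 w0 wb.
  exists [:: u, v & s']; split.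
  - by do 2![apply/nonneg_cons; split=> //].
  - by move=> x; rewrite !big_cons s'E wE addrA.
  - by rewrite !big_cons; lra.
  - by rewrite !big_cons asboolT//; lra.
exists (w :: s'); split.
- by apply/nonneg_cons.
- by move=> x; rewrite !big_cons s'E.
- by rewrite !big_cons; lra.
- by rewrite !big_cons asboolF//; lra.
Qed.

(** As [wdtc] is nonnegative, the last condition bounds the information of the family by
    [2 * wdtc mu]. *)
Definition admissible (mu : word A n -> R) s : Prop :=
  [/\ nonneg s, forall x, seq_sum s x = mu x & seq_potential s <= potential mu].

Lemma gain_gt0 (r : R) : (0 < n)%N -> 0 < r -> 0 < gain n r.
Proof.
move=> n0 r0; have N0 : 0 < n%:R :> R by rewrite ltr0n.
by rewrite !(mulr_gt0, invr_gt0, divr_gt0, expR_gt0, exprn_gt0).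
Qed.

(* A family of nearly maximal information has little bad mass, because
   splitting all its bad members would gain more. *)
Lemma admissible_small_bad (eps r : R) (mu : word A n -> R) :
  0 < eps -> 0 < r -> (forall x, 0 <= mu x) ->
  exists2 s, admissible mu s & bad_mass r s < eps.
Proof.
move=> eps0 r0 mu0.
have triv : admissible mu [:: mu].
  split.
  - by apply/nonneg_cons; split=> // -[|k] x.
  - by move=> x; rewrite /seq_sum big_seq1.
  - by rewrite /seq_potential big_seq1.
(* For [n = 0] the gain vanishes, but no weight is bad. *)
have [n0|n0] := posnP n.
  exists [:: mu] => //; rewrite /bad_mass big_cons big_nil asboolF//.
  by move=> /(bad_nontrivial r0 mu0)[]; rewrite n0.
pose E : set R := [set e | exists2 s, admissible mu s & e = seq_ent s]%classic.
have E0 : (E !=set0)%classic by exists (seq_ent [:: mu]); exists [:: mu].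
have Eub : has_ubound E by exists 0 => _ [s [s0 _ _] ->]; exact: seq_ent_le0.
have c0 : 0 < gain n r * eps by rewrite mulr_gt0 ?gain_gt0.
(* Bad mass at least [eps] would let a refinement exceed the supremum. *)
have [_ [s sA ->] lt_s] := sup_adherent c0 (conj E0 Eub).
exists s => //; rewrite ltNge; apply/negP => le_bad.
have [s0 sE sp] := sA; have [s' [s'0 s'E s'p s'e]] := refine_bad r0 s0.
have : seq_ent s' <= sup E.
  apply: ub_le_sup => //; exists s' => //; split=> // [x|]; first by rewrite s'E.
  exact: le_trans s'p sp.
have := ler_wpM2l (ltW (gain_gt0 n0 r0)) le_bad; lra.
Qed.

End Decomposition.

(** * From families of weights to fuzzy partitions *)

Section FuzzyPartition.
Set Implicit Arguments.
Unset Strict Implicit.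
Variables (R : realType) (T : finType).

Lemma I_muE k (mu : T -> R) (rho : 'I_k -> T -> R) : is_prob mu -> fuzzy_partition rho ->
  I_mu mu rho = \sum_j ent (fun x => rho j x * mu x) - ent mu.
Proof.
move=> hmu [rho01 rho1].
have -> : ent mu = \sum_j \sum_x rho j x * mu x * ln (mu x).
  rewrite exchange_big/=; apply: eq_bigr => x _.
  by rewrite -!mulr_suml rho1 mul1r /mass hmu.2 divr1.
rewrite -sumrB; apply: eq_bigr => j _; rewrite -sumrB; apply: eq_bigr => x _.
rewrite -mulr_suml rho1 mul1r -mulrBr.
have p0 y : 0 <= rho j y * mu y.
  by rewrite mulr_ge0 ?hmu.1//; case/andP: (rho01 j y).
have [->|px] := eqVneq (rho j x * mu x) 0; first by rewrite !mul0r.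
have px0 : 0 < rho j x * mu x by rewrite lt_def px p0.
have mx0 : 0 < mu x.
  by rewrite lt_def hmu.1 andbT; apply: contra_neq px => ->; rewrite mulr0.
have M0 := lt_le_trans px0 (le_mass x p0).
rewrite -/(mass (fun y => rho j y * mu y)); congr (_ * _).
by rewrite invfM mulrA [LHS]ln_div ?posrE ?divr_gt0.
Qed.

(** The default [d] on null points of [mu] lets a family of densities sum to 1 everywhere. *)
Definition density (mu w : T -> R) (d : R) : T -> R :=
  fun x => if mu x == 0 then d else w x / mu x.

Lemma densityK mu w d : (forall x, mu x = 0 -> w x = 0) ->
  (fun x => density mu w d x * mu x) = w.
Proof.
move=> wmu; apply/funext => x; rewrite /density; case: eqVneq => [m0|m0].
  by rewrite m0 mulr0 wmu.
by rewrite divfK.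
Qed.

End FuzzyPartition.

(* rho_1 is [rho ord0]; rho_2, ..., rho_k are [rho j] for j <> ord0 (k = k'.+1). *)
Theorem theorem6p1 (R : realType) (A : finType) (n : nat) (eps r : R)
  (heps : 0 < eps) (hr : 0 < r) (mu : word A n -> R) (hmu : is_prob mu) :
  exists (k : nat) (rho : 'I_k.+1 -> word A n -> R),
    [/\ fuzzy_partition rho,
        I_mu mu rho <= 2 * DTC mu,
        integ mu (rho ord0) < eps &
        forall j : 'I_k.+1, j != ord0 ->
          0 < integ mu (rho j) /\
          satisfies_T (cond_meas mu (rho j)) (r * n%:R / 200) r].
Proof.
have [mu0 mu1] := hmu.
have [s [s0 sE sp] s_bad] := @admissible_small_bad R A n eps r mu heps hr mu0.
pose good (w : word A n -> R) := (0 < mass w) && ~~ `[< bad r w >].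
pose sg := [seq w <- s | good w]; pose sb := [seq w <- s | ~~ good w].
have sg0 : nonneg sg by exact: nonneg_filter.
have sb0 : nonneg sb by exact: nonneg_filter.
(* Index 0 carries all discarded pieces merged, the others one good piece each. *)
pose W (j : 'I_(size sg).+1) := if unlift ord0 j is Some i then nth (fun=> 0) sg i else seq_sum sb.
have W0 j x : 0 <= W j x.
  by rewrite /W; case: unliftP => [i|] _; [exact: sg0|exact: seq_sum_ge0].
have Wsum (F : (word A n -> R) -> R) :
    \sum_j F (W j) = F (seq_sum sb) + \sum_(w <- sg) F w.
  rewrite big_ord_recl {1}/W unlift_none; congr (_ + _).
  rewrite (big_nth (fun=> 0)) big_mkord; apply: eq_bigr => i _.
  by rewrite /W liftK.
have split_seq (F : (word A n -> R) -> R) :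
    \sum_(w <- s) F w = \sum_(w <- sg) F w + \sum_(w <- sb) F w.
  by rewrite (bigID good)/= !big_filter.
have Wmu x : \sum_j W j x = mu x.
  rewrite (Wsum (fun w => w x)) -sE /seq_sum (split_seq (fun w => w x)); exact: addrC.
have Wac j : forall x, mu x = 0 -> W j x = 0.
  move=> x mx; apply/eqP; rewrite eq_le W0 andbT -mx -Wmu (bigD1 j)//= lerDl.
  exact: sumr_ge0.
(* Null points of [mu] are given entirely to index 0. *)
pose rho j := density mu (W j) (j == ord0)%:R.
have rhoE j : (fun x => rho j x * mu x) = W j by exact: densityK (Wac j).
have integE j : integ mu (rho j) = mass (W j) by rewrite -rhoE.
have fp : fuzzy_partition rho.
  have rho_ge0 j x : 0 <= rho j x.
    by rewrite /rho /density; case: ifP => // _; rewrite divr_ge0.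
  have rho_sum x : \sum_j rho j x = 1.
    rewrite /rho /density; have [mx|mx] := eqVneq (mu x) 0.
      by rewrite (bigD1 ord0)//= big1 ?addr0// => j /negPf ->.
    by rewrite -mulr_suml Wmu divff.
  split=> // j x; rewrite rho_ge0 -(rho_sum x) (bigD1 j)//= lerDl.
  by apply: sumr_ge0.
exists (size sg), rho; split=> //.
(* Merging lowers the information, and the budget on the potential bounds it by [2 * DTC mu]. *)
- rewrite I_muE//; under eq_bigr do rewrite rhoE.
  rewrite (Wsum (@ent _ _)); have := ent_seq_sum sb0.
  have := split_seq (@ent _ _); rewrite -/(seq_ent sb) -/(seq_ent s).
  have DE : DTC mu = wdtc mu.
    rewrite /DTC /wdtc /entropy /ent /mass mu1; congr (- _ - _).
    by apply: eq_bigr => x _; rewrite divr1.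
  have := sp; rewrite DE /potential /seq_potential big_split/= -mulr_sumr -/(seq_ent s).
  have : 0 <= \sum_(w <- s) wdtc w.
    elim: (s) s0 => [|w s' IH]; first by rewrite big_nil.
    move=> /nonneg_cons[w0 /IH s'0]; rewrite big_cons addr_ge0//.
    exact: wdtc_ge0.
  lra.
(* A discarded piece is bad or has zero mass, so the merged mass is at most [bad_mass r s]. *)
- rewrite integE /W unlift_none; apply: le_lt_trans s_bad.
  have -> : mass (seq_sum sb) = \sum_(w <- sb) mass w.
    by rewrite /mass /seq_sum exchange_big.
  rewrite big_filter /bad_mass.
  elim: (s) s0 => [|w s' IH]; first by rewrite !big_nil.
  move=> /nonneg_cons[w0 /IH le_s']; rewrite !big_cons /good negb_and negbK.
  case: (asboolP (bad r w)) => [wb|wg]; first by rewrite orbT lerD2l.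
  rewrite orbF -leNgt; case: ifP => // m0; have := mass_ge0 w0; lra.
- move=> j j0; rewrite integE.
  have jW : good (W j).
    rewrite /W; case: unliftP j0 => [i ->|->]; last by rewrite eqxx.
    move=> _; have : all good sg by exact: filter_all.
    by move/(all_nthP (fun=> 0)); apply.
  have [m0 /asboolPn nb] := andP jW; split=> //.
  have -> : cond_meas mu (rho j) = fun x => W j x / mass (W j).
    by apply/funext => x; rewrite /cond_meas integE -rhoE.
  by apply: contrapT => nT; apply: nb.
Qed.
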